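(* Let $n\ge 3$ and $Q_{2^n}=\langle r,s: r^{2^{n-1}}=1,\ r^{2^{n-2}}=s^2,\ srs^{-1}=r^{-1}\rangle$. The non-trivial subgroups of $Q_{2^n}$ are either of Type-I: $\langle r^d\rangle$, where $d\mid 2^{n-1}$; or of Type-II: $\langle r^d, r^i s\rangle$, where $d\mid 2^{n-1}$ and $0\le i\le 2^{n-2}$. Moreover, in the graph $\Gamma(Q_{2^n})$: (a) a vertex of Type-I, say $\langle r^{d_1}\rangle$, is adjacent to a vertex of Type-II, say $\langle r^{d_2}, r^i s\rangle$, if and only if $(d_1,d_2)=1$; (b) any two vertices of Type-II, say $\langle r^{d_1}, r^i s\rangle$ and $\langle r^{d_2}, r^j s\rangle$, are adjacent if and only if either of the following holds: (i) $(d_1,d_2)=1$; (ii) $(d_1,d_2)=2$ and $i-j$ is odd.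
   Context: For a finite group $G$, the co-maximal subgroup graph $\Gamma(G)$ is the simple undirected graph whose vertices are the non-trivial proper subgroups of $G$, two distinct vertices $H,K$ being adjacent if and only if $HK=G$, where $HK=\{hk: h\in H, k\in K\}$. $(a,b)$ denotes the greatest common divisor of $a$ and $b$. $d$, $d_1$, $d_2$ denote positive divisors of $2^{n-1}$.
   Formalization: Part (b) excludes n = 3 with d_1 = d_2 = 4, where it fails: in Q_8, ⟨r^4, s⟩ and ⟨r^4, rs⟩ are adjacent although (4,4) = 4; since r^4 = 1 and s^2 = r^2, these vertices are covered with d_1 = d_2 = 2. *)

(* Defs.v *)
From mathcomp Require Import all_boot all_fingroup all_solvable.

Set Implicit Arguments.
Unset Strict Implicit.
Unset Printing Implicit Defensive.

Local Open Scope nat_scope.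
Local Open Scope group_scope.

Section ComaximalSubgroupGraph.

Variables (gT : finGroupType) (G : {group gT}).

Definition comax_vertices : {set {group gT}} :=
  [set H : {group gT} | (H :!=: 1) && (H \proper G)].

Definition comax_adj : rel {group gT} := fun H K =>
  [&& H \in comax_vertices, K \in comax_vertices, H != K & H * K == G :> {set gT}].

End ComaximalSubgroupGraph.

Section Quaternion.

Variable gT : finGroupType.

(* G = < r, s : r^(2^(n-1)) = 1, r^(2^(n-2)) = s^2, s r s^-1 = r^-1 >.
   The library predicate "\isog Grp" does not name the generators, hence the
   first two clauses. Together with the third they make (r, s) presenting
   generators: mapping the abstract generators to r and s gives an epimorphism
   onto G, which is injective because the presented group is finite and
   isomorphic to G. *)
Definition quaternion_presentation (n : nat) (G : {group gT}) (r s : gT) : Prop :=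
  [/\ <<[set r; s]>> = G,
      [/\ r ^+ (2 ^ (n - 1))%N = 1, r ^+ (2 ^ (n - 2))%N = s ^+ 2
        & s * r * s^-1 = r^-1]
    & G \isog Grp (x : y : (x ^+ (2 ^ (n - 1))%N = 1,
                            x ^+ (2 ^ (n - 2))%N = y ^+ 2,
                            y * x * y^-1 = x^-1))].

Definition typeI (r : gT) (d : nat) : {group gT} := <[(r ^+ d)%g]>%G.

Definition typeII (r s : gT) (d i : nat) : {group gT} :=
  <<[set (r ^+ d)%g; (r ^+ i * s)%g]>>%G.

End Quaternion.

(* Main.v *)
Require Import Defs.
From mathcomp Require Import all_boot all_fingroup all_solvable ssrint.

(** The argument is carried out in the dicyclic group of order [4 * m], given
    by generators [r], [s] with [s * r * s^-1 = r^-1] and [s ^+ 2 = r ^+ m];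
    the quaternion group of order [2 ^ n] is the case [m = 2 ^ (n - 2)]. By
    analogy with the dihedral group, the elements [r^a] are called rotations
    and the elements [r^a * s] reflections.

    The relations show that [<r^d>] is normalised by [x = r^i * s] and that
    [x ^+ 2 = r ^+ m]. So, for [d %| m], the subgroup [<r^d, x>] is the union
    of the cosets [<r^d>] and [<r^d> x] ([typeII_cosets]). Since [r] has order
    [2 * m] and [s] lies outside [<r>], membership in a Type-II subgroup is a
    congruence: [r^a] belongs to it iff [d %| a] ([mem_typeII_rot]), and
    [r^a * s] iff [a = i] modulo [d] ([mem_typeII_ref]). The parameter
    [d = 2 * m] does not divide [m]; below it is enough to replace such a
    subgroup by the larger one with parameter 2 or 4.

    A subgroup [H] meets [<r>] in some [<r^d>]. If [H] contains some [r^a * s]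
    then it contains [r ^+ m], so [a] can be reduced modulo [m], and [H] is
    generated by [r^d] and [r^a * s] ([dicyclic_subgroup]).

    For adjacency, a Type-II vertex has [d] even: [d] is a power of 2, and
    [d = 1] gives the whole group. Products that are the whole group come from
    subgroups of index two: [<r>] and [<r^2, r^i * s>] have index two, and a
    subgroup of index two times a subgroup not contained in it is everything
    ([mulg_index2]). Products that are proper come from two obstructions. If
    the parameters are even, and [i] and [j] have the same parity when both
    factors are of Type-II, both factors lie in the proper subgroup
    [<r^2, r^i * s>] ([mul_typeI_typeII_neq], [mul_typeII_parity]). If both
    Type-II parameters are divisible by 4, if [4 %| m], and if [i - j] is odd,
    then [r^2] is not in the product ([mul_typeII_dvd4_neq]). The condition
    [4 %| m] fails only for [n = 3], where both parameters would have to be 4,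
    which is the excluded case. *)

Set Implicit Arguments.
Unset Strict Implicit.

Local Open Scope nat_scope.

(** * Arithmetic, cyclic subgroups and subgroups of index two *)

Lemma odd_distn (i j : nat) : odd `|i - j| = odd i (+) odd j.
Proof.
have [le_ij | /ltnW le_ji] := leqP i j.
  by rewrite distnEr // oddB // addbC.
by rewrite distnEl // oddB.
Qed.

Lemma eqn_mod2 a b : (a == b %[mod 2]) = (odd a == odd b).
Proof. by rewrite !modn2; case: (odd a) (odd b) => [] []. Qed.

Lemma joing_cycle_sqr (gT : finGroupType) (C : {group gT}) (x : gT) :
    x \in 'N(C)%g -> (x ^+ 2)%g \in C ->
  (C <*> <[x]>)%g = C :|: (C :* x)%g.
Proof.
move=> nCx Cx2; apply/eqP; rewrite eqEsubset; apply/andP; split; last first.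
  rewrite subUset joing_subl /=; apply/subsetP=> y /rcosetP[c Cc ->].
  by rewrite groupM // mem_gen // inE ?Cc // cycle_id orbT.
rewrite norm_joinEr ?cycle_subG //; apply/subsetP=> y /mulsgP[c z Cc /cycleP[k ->] ->].
(* x ^+ k is x ^+ odd k up to a power of x ^+ 2, which lies in C. *)
rewrite -(odd_double_half k) addnC expgD -mul2n expgM mulgA inE mem_rcoset.
have Ccx : (c * (x ^+ 2) ^+ k./2)%g \in C by rewrite groupM // groupX.
by case: (odd k); rewrite ?expg1 ?expg0 ?mulg1 ?mulgK Ccx ?orbT.
Qed.

Lemma mem_cycle_exp (gT : finGroupType) (x : gT) (d a : nat) :
  d %| #[x]%g -> ((x ^+ a)%g \in <[(x ^+ d)%g]>%g) = (d %| a).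
Proof.
move=> d_x; apply/idP/idP => [/cycleP[k] | /dvdnP[k ->]]; last first.
  by rewrite mulnC expgM mem_cycle.
rewrite -expgM => /eqP; rewrite eq_expg_mod_order => /eqP e_a.
by rewrite /dvdn -(modn_dvdm a d_x) e_a modn_dvdm // modnMr.
Qed.

Lemma mulg_index2 (gT : finGroupType) (G H K : {group gT}) :
    H \subset G -> #|G| = #|H|.*2 -> K \subset G -> ~~ (K \subset H) ->
  (H * K)%g = G.
Proof.
move=> sHG oG sKG not_sKH.
have iGH : #|G : H|%g = 2.
  by apply/eqP; rewrite -(eqn_pmul2l (cardG_gt0 H)) Lagrange // oG muln2.
apply: mulg_normal_maximal not_sKH => //; first exact: index2_normal.
by apply: p_index_maximal; rewrite ?iGH.
Qed.

(** The condition that the vertices be distinct is redundant: if they were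
    equal, their product would be the vertex itself, which is proper. *)
Lemma comax_adjE (gT : finGroupType) (G H K : {group gT}) :
    H \in comax_vertices G -> K \in comax_vertices G ->
  comax_adj G H K = ((H * K)%g == G :> {set gT}).
Proof.
move=> vH vK; rewrite /comax_adj vH vK /=; apply: andb_idl => /eqP defG.
apply: contraL vH => /eqP eqHK.
by rewrite inE -defG -eqHK mulGid properxx andbF.
Qed.

Lemma comax_adj_sym (gT : finGroupType) (G H K : {group gT}) :
  comax_adj G H K = comax_adj G K H.
Proof.
suff imp (A B : {group gT}) : comax_adj G A B -> comax_adj G B A.
  by apply/idP/idP; apply: imp.
case/and4P=> vA vB neqAB /eqP defG; apply/and4P; split=> //; first by rewrite eq_sym.
by apply/eqP; rewrite -(invGid G) -defG invMg !invGid.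
Qed.

Lemma dvdn_pow2_cases d k : d %| 2 ^ k -> [\/ d = 1, d = 2 | 4 %| d].
Proof.
case/dvdn_pfactor=> // -[|[|e]] _ ->; [by constructor 1 | by constructor 2 |].
by constructor 3; rewrite (@dvdn_exp2l 2 2).
Qed.

Lemma dvdn_pow2_dichotomy d k : d %| 2 ^ k -> d = 1 \/ 2 %| d.
Proof.
case/dvdn_pow2_cases=> [-> | -> | d_4]; [by left | by right |].
by right; apply: dvdn_trans d_4.
Qed.

(** * Consequences of the dicyclic relations *)

Section DicyclicRelations.

Variables (gT : finGroupType) (m : nat) (r s : gT).
Hypotheses (rs_inv : (s * r * s^-1)%g = (r^-1)%g).
Hypotheses (s_sqr : (s ^+ 2)%g = (r ^+ m)%g).

Lemma dicyclic_comm a : (s * r ^+ a)%g = (r ^- a * s)%g.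
Proof.
have -> : (r ^- a = (s * r * s^-1) ^+ a)%g by rewrite rs_inv expgVn.
elim: a => [|a IHa]; first by rewrite !expg0 mulg1 mul1g.
by rewrite expgSr mulgA IHa expgSr -!mulgA mulVg mulg1.
Qed.

Lemma dicyclic_comm' a : (r ^+ a * s)%g = (s * r ^- a)%g.
Proof.
apply: (mulIg s^-1%g); rewrite mulgK; apply: invg_inj.
by rewrite !invMg !invgK mulgA dicyclic_comm mulgK.
Qed.

Lemma dicyclic_sqr i : ((r ^+ i * s) ^+ 2)%g = (r ^+ m)%g.
Proof.
by rewrite expgS expg1 -mulgA [(s * _)%g]mulgA dicyclic_comm -!mulgA mulKVg -s_sqr.
Qed.

(** For [d %| m] the square of [r ^+ i * s] lies in [<r^d>], so two cosets
    suffice. *)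
Lemma typeII_cosets d i : d %| m ->
  typeII r s d i = <[(r ^+ d)%g]>%g :|: (<[(r ^+ d)%g]> :* (r ^+ i * s))%g :> {set gT}.
Proof.
move=> d_m; rewrite /= -joing_cycle_sqr; last first.
- by rewrite dicyclic_sqr -(divnK d_m) mulnC expgM mem_cycle.
- rewrite -cycle_subG norms_cycle conjgE invMg -!mulgA.
  rewrite [(r ^+ d * _)%g]mulgA -expgD addnC expgD -mulgA mulKg.
  by rewrite dicyclic_comm' mulKg groupV cycle_id.
by rewrite /cycle joing_idl joing_idr.
Qed.

(** Normal form of the elements of [<r, s>], which is [typeII r s 1 0]. *)
Lemma mem_dicyclic x : x \in typeII r s 1 0 ->
  exists a, x = (r ^+ a)%g \/ x = (r ^+ a * s)%g.
Proof.
rewrite [_ \in _](congr1 (fun A : {set gT} => x \in A) (typeII_cosets 0 (dvd1n m))) //.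
rewrite expg1 expg0 mul1g => /setUP[/cycleP[a ->] | /rcosetP[_ /cycleP[a ->] ->]].
  by exists a; left.
by exists a; right.
Qed.

(** The relations bound the order by [4 * m]; when the bound is reached nothing
    collapses. *)
Lemma dicyclic_order_coset :
  0 < m -> m.*2.*2 <= #|typeII r s 1 0| -> #[r]%g = m.*2 /\ s \notin <[r]>%g.
Proof.
move=> m_gt0; rewrite (typeII_cosets 0 (dvd1n m)) // expg1 expg0 mul1g => leQ.
have r2m : (r ^+ m.*2 = 1)%g.
  (* r ^+ m commutes with s, being s ^+ 2, but is also inverted by it. *)
  have eq_rs : (r ^+ m * s = r ^- m * s)%g.
    by rewrite -dicyclic_comm -s_sqr -expgSr -expgS.
  by rewrite -addnn expgD {1}(mulIg _ _ _ eq_rs) mulVg.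
have le_r : #[r]%g <= m.*2.
  by rewrite dvdn_leq ?double_gt0 // order_dvdn r2m.
have le_U : #|<[r]> :|: <[r]> :* s|%g <= #[r]%g.*2.
  by rewrite (leq_trans (leq_card_setU _ _).1) // card_rcoset addnn.
have o_r : #[r]%g = m.*2.
  by apply/eqP; rewrite eqn_leq le_r -leq_double (leq_trans leQ).
split=> //; apply/negP=> r_s; move: leQ.
rewrite rcoset_id // setUid [#|_|]o_r leqNgt.
by rewrite ltn_double -addnn -[X in X < _]addn0 ltn_add2l m_gt0.
Qed.

End DicyclicRelations.

(** * Subgroups of the dicyclic group *)

Section Dicyclic.

Variables (gT : finGroupType) (m : nat) (r s : gT).
Hypotheses (m_gt0 : 0 < m).
Hypotheses (rs_inv : (s * r * s^-1)%g = (r^-1)%g).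
Hypotheses (s_sqr : (s ^+ 2)%g = (r ^+ m)%g).
Hypothesis (o_r : #[r]%g = m.*2) (r's : s \notin <[r]>%g).

Local Notation Q := (typeII r s 1 0).

Lemma mem_typeII_rot d i a : d %| m -> ((r ^+ a)%g \in typeII r s d i) = (d %| a).
Proof.
move=> d_m; have d_2m : d %| #[r]%g by rewrite o_r -muln2 dvdn_mulr.
rewrite (typeII_cosets rs_inv s_sqr i d_m) inE mem_cycle_exp // orbC.
case: rcosetP => // -[_ /cycleP[k ->]]; rewrite mulgA -expgM -expgD => def_ra.
by case/negP: r's; rewrite -(groupMl _ (mem_cycle r (d * k + i))) -def_ra mem_cycle.
Qed.

Lemma mem_typeII_ref d i a : d %| m ->
  ((r ^+ a * s)%g \in typeII r s d i) = (a == i %[mod d]).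
Proof.
move=> d_m; have d_2m : d %| #[r]%g by rewrite o_r -muln2 dvdn_mulr.
rewrite (typeII_cosets rs_inv s_sqr i d_m) inE orbC mem_rcoset invMg mulgA mulgK.
have -> : (r ^+ a * r ^- i \in <[r ^+ d]>)%g = (a == i %[mod d]).
  wlog le_ia : a i / i <= a => [IH|].
    have [/IH // | /ltnW/IH eq_ai] := leqP i a.
    by rewrite eq_sym -eq_ai -groupV invMg invgK.
  by rewrite -{1}(subnK le_ia) expgD mulgK mem_cycle_exp // eqn_mod_dvd.
case: (_ == _) => //=; apply: contraNF r's => /cycleP[k]; rewrite -expgM => def_ras.
by rewrite -(groupMl _ (mem_cycle r a)) def_ras mem_cycle.
Qed.

Lemma card_typeII d i : d %| m -> #|typeII r s d i| = (m.*2 %/ d).*2.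
Proof.
move=> d_m; have d_2m : d %| #[r]%g by rewrite o_r -muln2 dvdn_mulr.
rewrite (typeII_cosets rs_inv s_sqr i d_m) cardsU card_rcoset.
have -> : <[r ^+ d]>%g :&: (<[r ^+ d]> :* (r ^+ i * s))%g = set0.
  apply/setP=> y; rewrite in_set0; apply/setIP=> -[C_y].
  rewrite mem_rcoset -groupV invMg invgK groupMr ?groupV //.
  move/(subsetP (cycleX r d)); rewrite groupMl ?mem_cycle //.
  exact/negP.
by rewrite cards0 subn0 -orderE orderXdiv // o_r addnn.
Qed.

Lemma typeII_sub d e i j :
  e %| m -> e %| d -> i = j %[mod e] -> typeII r s d i \subset typeII r s e j.
Proof.
move=> e_m e_d eq_ij; rewrite gen_subG; apply/subsetP=> _ /set2P[] ->.
  by rewrite mem_typeII_rot.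
by rewrite mem_typeII_ref //; apply/eqP.
Qed.

Lemma typeII_subQ d i : typeII r s d i \subset Q.
Proof. by apply: typeII_sub; rewrite ?dvd1n ?modn1. Qed.

Lemma typeII1 i : typeII r s 1 i = Q.
Proof.
by apply: val_inj; apply/eqP; rewrite eqEsubset !typeII_sub ?dvd1n ?modn1.
Qed.

Lemma typeI_subQ d : typeI r d \subset Q.
Proof. by rewrite cycle_subG mem_typeII_rot dvd1n. Qed.

Lemma card_dicyclic : #|Q| = m.*2.*2.
Proof. by rewrite card_typeII ?dvd1n ?divn1. Qed.

(** The trivial subgroup is covered too, as [typeI r m.*2]. *)
Lemma dicyclic_subgroup (H : {group gT}) : H \subset Q ->
  (exists2 d, d %| m.*2 & H = typeI r d) \/
  (exists d i, [/\ d %| m.*2, i <= m & H = typeII r s d i]).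
Proof.
move=> sHQ.
have [d d_2m defHr] : exists2 d, d %| m.*2 & H :&: <[r]>%g = <[(r ^+ d)%g]>%g :> {set gT}.
  have dvH : #|H :&: <[r]>%g| %| m.*2 by rewrite -o_r cardSg ?subsetIr.
  exists (m.*2 %/ #|H :&: <[r]>%g|); first by rewrite dvdn_div.
  apply/eqP; rewrite (eq_subG_cyclic (cycle_cyclic r)) ?subsetIr ?cycleX //.
  by rewrite -orderE orderXdiv ?o_r ?dvdn_div // divnA // mulKn // double_gt0.
have [sHr | /subsetPn[x Hx r'x]] := boolP (H \subset <[r]>%g).
  by left; exists d => //; apply: val_inj; rewrite /= -defHr (setIidPl sHr).
right; have [a [def_x | def_x]] := mem_dicyclic rs_inv s_sqr (subsetP sHQ x Hx).
  by rewrite def_x mem_cycle in r'x.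
have Hrm : (r ^+ m)%g \in H by rewrite -(dicyclic_sqr rs_inv s_sqr a) -def_x groupX.
(* r ^+ m \in H makes the exponent of the reflection matter only modulo m. *)
have Hy : (r ^+ (a %% m) * s)%g \in H.
  rewrite -(groupMl _ (groupX (a %/ m) Hrm)) -expgM mulgA -expgD mulnC -divn_eq.
  by rewrite -def_x.
exists d, (a %% m); split=> //; first by rewrite ltnW ?ltn_pmod.
have Hrd : (r ^+ d)%g \in H by have := cycle_id (r ^+ d)%g; rewrite -defHr => /setIP[].
apply: val_inj; apply/eqP; rewrite eqEsubset /= gen_subG subUset !sub1set Hrd Hy !andbT.
apply/subsetP=> z Hz.
have Hrz (w : gT) : w \in H -> w \in <[r]>%g -> w \in typeII r s d (a %% m).
  move=> Hw rw; have : w \in <[(r ^+ d)%g]>%g by rewrite -defHr inE Hw.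
  by apply: subsetP; rewrite cycle_subG mem_gen ?set21.
have [b [def_z | def_z]] := mem_dicyclic rs_inv s_sqr (subsetP sHQ z Hz).
  by rewrite Hrz // def_z mem_cycle.
rewrite -(mulgKV (r ^+ (a %% m) * s)%g z) groupM //; last first.
  by rewrite mem_gen // set22.
apply: Hrz; first by rewrite groupM ?groupV.
by rewrite def_z invMg mulgA mulgK groupM ?groupV ?mem_cycle.
Qed.

(** * Products of two subgroups of the dicyclic group *)

Hypothesis m_even : 2 %| m.

Lemma typeII2_neqQ i : ~~ (Q \subset typeII r s 2 i).
Proof.
apply/subsetPn; exists r; first by rewrite -[r]expg1 mem_typeII_rot.
by rewrite -[r in r \in _]expg1 mem_typeII_rot.
Qed.

Lemma mul_typeI_typeII_neq d1 d2 i :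
  2 %| d1 -> 2 %| d2 -> (typeI r d1 * typeII r s d2 i)%g <> Q.
Proof.
move=> d1_2 d2_2 defQ; case/negP: (typeII2_neqQ i).
by rewrite -defQ mul_subG ?typeII_sub // cycle_subG mem_typeII_rot.
Qed.

Lemma mul_typeI1_typeII d i : (typeI r 1 * typeII r s d i)%g = Q.
Proof.
apply: mulg_index2 (typeI_subQ 1) _ (typeII_subQ d i) _.
  by rewrite card_dicyclic /= expg1 [#|_|]o_r.
apply/subsetPn; exists (r ^+ i * s)%g; first by rewrite mem_gen ?set22.
by rewrite /= expg1 groupMl ?mem_cycle.
Qed.

Lemma mul_typeII_parity d1 d2 i j : 2 %| d1 -> 2 %| d2 ->
  (typeII r s d1 i * typeII r s d2 j)%g = Q -> odd i (+) odd j.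
Proof.
move=> d1_2 d2_2 defQ; rewrite -negb_eqb; apply/negP=> /eqP eq_ij.
case/negP: (typeII2_neqQ i).
by rewrite -defQ mul_subG ?typeII_sub // !modn2 eq_ij.
Qed.

Lemma mul_typeII2 d i j : odd i (+) odd j ->
  (typeII r s 2 i * typeII r s d j)%g = Q.
Proof.
move=> odd_ij; apply: mulg_index2 (typeII_subQ 2 i) _ (typeII_subQ d j) _.
  by rewrite card_dicyclic card_typeII // divn2 doubleK.
apply/subsetPn; exists (r ^+ j * s)%g; first by rewrite mem_gen ?set22.
by rewrite mem_typeII_ref // eqn_mod2 eq_sym negb_eqb.
Qed.

Lemma mul_typeII_dvd4_neq d1 d2 i j : 4 %| m -> 4 %| d1 -> 4 %| d2 ->
  (typeII r s d1 i * typeII r s d2 j)%g <> Q.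
Proof.
move=> m_4 d1_4 d2_4 defQ.
(* Suppose r ^+ 2 = h * k. If k is a rotation, it lies in the first factor's
   overgroup <r^4, r^i s>, hence so does r ^+ 2, which is false. Otherwise
   k = r ^+ b * s with b = j mod 4, and k = h^-1 * r ^+ 2 lies in <r^2, r^i s>,
   so that i and j have the same parity, against odd_ij. *)
have odd_ij : odd i (+) odd j.
  by apply: mul_typeII_parity defQ; apply: (@dvdn_trans 4).
have : (r ^+ 2)%g \in Q by rewrite mem_typeII_rot.
rewrite -defQ => /mulsgP[h k].
move=> /(subsetP (typeII_sub m_4 d1_4 (erefl (i %% 4)))) Hh.
move=> /(subsetP (typeII_sub m_4 d2_4 (erefl (j %% 4)))) Kk def_r2.
have [b [def_k | def_k]] := mem_dicyclic rs_inv s_sqr (subsetP (typeII_subQ 4 j) k Kk).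
  move: Kk; rewrite def_k mem_typeII_rot // -(mem_typeII_rot i b m_4) -def_k => Hk.
  by have := groupM Hh Hk; rewrite -def_r2 mem_typeII_rot.
have H2h : h \in typeII r s 2 i by apply: (subsetP (typeII_sub _ _ (erefl _))) Hh.
have : (h * k)%g \in typeII r s 2 i by rewrite -def_r2 mem_typeII_rot.
rewrite groupMl // def_k mem_typeII_ref // eqn_mod2 => eq_bi.
move: Kk; rewrite def_k mem_typeII_ref // => /eqP/(congr1 odd).
rewrite !odd_mod // => eq_bj.
by move: odd_ij; rewrite -eq_bj (eqP eq_bi) addbb.
Qed.

End Dicyclic.

(** * The quaternion group *)

(** The relations by themselves only bound orders from above. The lower bound on the
    order comes from the known quaternion group of order [2 ^ n]: it satisfies
    the presentation, hence is a homomorphic image of [Q]. *)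
Lemma quaternion_dicyclic (n : nat) (gT : finGroupType) (Q : {group gT}) (r s : gT) :
    2 < n -> quaternion_presentation n Q r s ->
  [/\ Q = typeII r s 1 0, (s * r * s^-1)%g = (r^-1)%g,
      (s ^+ 2)%g = (r ^+ (2 ^ (n - 2))%N)%g,
      #[r]%g = (2 ^ (n - 2)).*2 & s \notin <[r]>%g].
Proof.
move=> n_gt2 [genQ [_ s_sqr rs_inv] presQ].
have defQ : Q = typeII r s 1 0 by apply: val_inj; rewrite /= expg1 expg0 mul1g genQ.
have leQ : (2 ^ (n - 2)).*2.*2 <= #|Q|.
  have -> : (2 ^ (n - 2)).*2.*2 = #|[set: 'Q_(2 ^ n)]|.
    have def_n : n = (n - 2).+2 by rewrite -addn2 subnK // ltnW.
    by rewrite card_quaternion // -!muln2 -!expnSr -def_n.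
  rewrite dvdn_leq ?cardG_gt0 //; apply: card_homg; rewrite presQ.
  have /existsP[[x y] /= /eqP[genxy rel1 rel2 rel3]] :=
    isoGrp_hom (Grp_quaternion n_gt2).
  (* The pair (x, y^-1) satisfies the relations: x ^+ (2 ^ (n - 2)) = y ^+ 2 is
     its own inverse, and conjugating by y^-1 on the left is conjugating by y on
     the right. *)
  apply/existsP; exists (x, y^-1)%g; apply/eqP => /=.
  rewrite -genxy cycleV invgK -mulgA -conjgE rel3 expgVn rel2 subn1 subn2 rel1.
  congr (_, (_, (_, _))); apply: (mulgI (x ^+ (2 ^ n.-2))%g).
  rewrite mulgV -expgD addnn -mul2n -expnS -rel1; congr (x ^+ (2 ^ _))%g.
  by case: (n) n_gt2 => [|[]].
rewrite defQ in leQ.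
have [] := dicyclic_order_coset rs_inv (esym s_sqr) _ leQ; first by rewrite expn_gt0.
by split.
Qed.

Unset Implicit Arguments.
Set Strict Implicit.

Theorem proposition1 (n : nat) (gT : finGroupType) (Q : {group gT}) (r s : gT)
    (hn : 3 <= n) (hQ : quaternion_presentation n Q r s) :
  [/\ (forall H : {group gT}, H \subset Q -> H <> 1%G ->
         (exists d : nat, d %| 2 ^ (n - 1) /\ H = typeI r d) \/
         (exists d i : nat,
            [/\ d %| 2 ^ (n - 1), i <= 2 ^ (n - 2) & H = typeII r s d i])),
      (forall d1 d2 i : nat,
         d1 %| 2 ^ (n - 1) -> d2 %| 2 ^ (n - 1) -> i <= 2 ^ (n - 2) ->
         typeI r d1 \in comax_vertices Q -> typeII r s d2 i \in comax_vertices Q ->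
         comax_adj Q (typeI r d1) (typeII r s d2 i) <-> gcdn d1 d2 = 1)
    & (forall d1 d2 i j : nat,
         d1 %| 2 ^ (n - 1) -> d2 %| 2 ^ (n - 1) ->
         i <= 2 ^ (n - 2) -> j <= 2 ^ (n - 2) ->
         (* in the excluded case typeII r s 4 i = typeII r s 2 i, so that the
            pair of vertices is covered with d1 = d2 = 2 *)
         ~ [/\ n = 3, d1 = 4 & d2 = 4] ->
         typeII r s d1 i \in comax_vertices Q -> typeII r s d2 j \in comax_vertices Q ->
         comax_adj Q (typeII r s d1 i) (typeII r s d2 j) <->
           gcdn d1 d2 = 1 \/ (gcdn d1 d2 = 2 /\ odd `|i - j|))].
Proof.
have [-> rs_inv s_sqr o_r r's] := quaternion_dicyclic hn hQ.
set m := 2 ^ (n - 2) in s_sqr o_r *.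
have m_gt0 : 0 < m by rewrite expn_gt0.
have def_2m : 2 ^ (n - 1) = m.*2 by rewrite -mul2n -expnS -subSn ?subSS // ltnW.
have m_even : 2 %| m by rewrite dvdn_exp // subn_gt0.
have evenP d i : d %| 2 ^ (n - 1) ->
  typeII r s d i \in comax_vertices (typeII r s 1 0) -> 2 %| d.
  case/dvdn_pow2_dichotomy=> // ->.
  by rewrite (typeII1 rs_inv s_sqr o_r r's) inE properxx andbF.
split.
- move=> H sHQ _; rewrite def_2m.
  have [[d d_2m ->] | [d [i [d_2m le_im ->]]]] :=
    dicyclic_subgroup m_gt0 rs_inv s_sqr o_r sHQ; first by left; exists d.
  by right; exists d, i.
- move=> d1 d2 i dv1 dv2 _ v1 v2; rewrite comax_adjE //.
  have d2_2 := evenP _ _ dv2 v2; split=> [/eqP defQ | d12_1].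
    have [-> | d1_2] := dvdn_pow2_dichotomy dv1; first exact: gcd1n.
    by case: (mul_typeI_typeII_neq rs_inv s_sqr o_r r's m_even d1_2 d2_2 defQ).
  have [-> | d1_2] := dvdn_pow2_dichotomy dv1.
    by apply/eqP; apply: (mul_typeI1_typeII rs_inv s_sqr o_r r's).
  by have := dvdn_gcd 2 d1 d2; rewrite d12_1 d1_2 d2_2.
move=> d1 d2 i j dv1 dv2 _ _ excl v1 v2; rewrite comax_adjE // odd_distn.
have d1_2 := evenP _ _ dv1 v1; have d2_2 := evenP _ _ dv2 v2.
have gcd_neq1 : gcdn d1 d2 <> 1.
  by move=> d12_1; have := dvdn_gcd 2 d1 d2; rewrite d12_1 d1_2 d2_2.
split=> [/eqP defQ | [//|[d12_2 odd_ij]]].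
  right; split; last exact: (mul_typeII_parity rs_inv s_sqr o_r r's m_even d1_2 d2_2 defQ).
  have dv12 : gcdn d1 d2 %| 2 ^ (n - 1) by apply: dvdn_trans (dvdn_gcdl _ _) dv1.
  have [// | // | ] := dvdn_pow2_cases dv12; rewrite dvdn_gcd => /andP[d1_4 d2_4].
  have [n_gt3 | le_n3] := ltnP 3 n.
    have m_4 : 4 %| m by rewrite (@dvdn_exp2l 2 2) // leq_subRL // ltnW.
    by case: (mul_typeII_dvd4_neq rs_inv s_sqr o_r r's m_even m_4 d1_4 d2_4 defQ).
  (* For n = 3 the parameters divide 4 and are multiples of 4. *)
  have n3 : n = 3 by apply/eqP; rewrite eqn_leq le_n3.
  case: excl; split=> //; apply/eqP; rewrite eqn_dvd ?d1_4 ?d2_4 andbT.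
    by rewrite n3 in dv1.
  by rewrite n3 in dv2.
(* As gcdn d1 d2 = 2, one of the two parameters is 2 and its vertex has index 2. *)
have [d1_1 | -> | d1_4] := dvdn_pow2_cases dv1.
- by rewrite d1_1 in d1_2.
- by apply/eqP; apply: (mul_typeII2 rs_inv s_sqr o_r r's m_even).
have [d2_1 | d2_eq2 | d2_4] := dvdn_pow2_cases dv2.
- by rewrite d2_1 in d2_2.
- rewrite -comax_adjE // comax_adj_sym comax_adjE // d2_eq2.
  by apply/eqP; apply: (mul_typeII2 rs_inv s_sqr o_r r's m_even); rewrite // addbC.
by have := dvdn_gcd 4 d1 d2; rewrite d12_2 d1_4 d2_4.
Qed.
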